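(* As formal power series in $q$ (equivalently, for all complex $q$ with $|q|<1$), $$\sum_{n,r\ge 0} \frac{q^{n^2+2r^2}}{(q;q^2)_n\,(q^2;q^2)_r\,(q^2;q^4)_r\,(q;q)_{n-2r}} = \frac{(q^{28},q^{32},q^{60};q^{60})_\infty}{(q;q)_\infty},$$ where terms with $n<2r$ are interpreted as $0$.
   Context: Notation: $(a;q)_m=\prod_{j=0}^{m-1}(1-aq^j)$ for integers $m\ge 0$, $(a;q)_\infty=\prod_{j=0}^{\infty}(1-aq^j)$, and $(a_1,\dots,a_s;q)_\infty=(a_1;q)_\infty\cdots(a_s;q)_\infty$; the base may be replaced by any power of $q$ (e.g. $(a;q^4)_m=\prod_{j=0}^{m-1}(1-aq^{4j})$). The usual convention $1/(q;q)_m=0$ for integers $m<0$ is in force. *)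

(* Defs.v *)
From HB Require Import structures.
From mathcomp Require Import all_boot all_order all_algebra.
From mathcomp Require Import finmap boolp classical_sets.

Set Implicit Arguments.
Unset Strict Implicit.
Unset Printing Implicit Defensive.

Import GRing.Theory.
Local Open Scope ring_scope.

(** * The ring R[[q]] of formal power series *)

(* A series is given by its coefficients: [f k] is the coefficient of q^k. *)
Record fps (R : Type) := Fps { fps_coef :> nat -> R }.

Lemma fpsP (R : Type) (f g : fps R) : (forall k, f k = g k) -> f = g.
Proof. by case: f g => [f] [g] /= fg; congr Fps; apply/funext. Qed.

HB.instance Definition _ (R : Type) := gen_eqMixin (fps R).
HB.instance Definition _ (R : Type) := gen_choiceMixin (fps R).

Section FpsZmod.
Variable R : zmodType.
Implicit Types f g h : fps R.

Definition fps_zero : fps R := Fps (fun=> 0).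
Definition fps_opp f : fps R := Fps (fun k => - f k).
Definition fps_add f g : fps R := Fps (fun k => f k + g k).

Fact fps_addA : associative fps_add.
Proof. by move=> f g h; apply: fpsP => k; rewrite /= addrA. Qed.
Fact fps_addC : commutative fps_add.
Proof. by move=> f g; apply: fpsP => k; rewrite /= addrC. Qed.
Fact fps_add0 : left_id fps_zero fps_add.
Proof. by move=> f; apply: fpsP => k; rewrite /= add0r. Qed.
Fact fps_addN : left_inverse fps_zero fps_opp fps_add.
Proof. by move=> f; apply: fpsP => k; rewrite /= addNr. Qed.

HB.instance Definition _ :=
  GRing.isZmodule.Build (fps R) fps_addA fps_addC fps_add0 fps_addN.

End FpsZmod.

Section FpsRing.
Variable R : comNzRingType.
Implicit Types f g h : fps R.

Definition fps_one : fps R := Fps (fun k => (k == 0%N)%:R).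
Definition fps_mul f g : fps R :=
  Fps (fun k => \sum_(i < k.+1) f i * g (k - i)%N).

Fact fps_mul_trunc n f g k : (k < n)%N ->
  fps_mul f g k = ((\poly_(i < n) f i) * (\poly_(i < n) g i))`_k.
Proof.
move=> kn; rewrite coefM; apply: eq_bigr => i _.
have ik : (i <= k)%N by rewrite -ltnS.
by rewrite !coef_poly (leq_ltn_trans ik kn) (leq_ltn_trans (leq_subr _ _) kn).
Qed.

Fact fps_mulC : commutative fps_mul.
Proof.
by move=> f g; apply: fpsP => k; rewrite !(fps_mul_trunc _ _ (ltnSn k)) mulrC.
Qed.

Fact fps_mulA : associative fps_mul.
Proof.
move=> f g h; apply: fpsP => k.
have trunc (u v : fps R) (p : {poly R}) :
    (\sum_(i < k.+1) fps_mul u v i * p`_(k - i))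
    = ((\poly_(i < k.+1) u i) * (\poly_(i < k.+1) v i) * p)`_k.
  by rewrite coefM; apply: eq_bigr => i _; rewrite -fps_mul_trunc.
rewrite fps_mulC !(fps_mul_trunc _ _ (ltnSn k)).
have step (u v w : fps R) :
    ((\poly_(i < k.+1) fps_mul u v i) * (\poly_(i < k.+1) w i))`_k =
    ((\poly_(i < k.+1) u i) * (\poly_(i < k.+1) v i) * \poly_(i < k.+1) w i)`_k.
  by rewrite -trunc coefM; apply: eq_bigr => i _; rewrite coef_poly ltn_ord.
rewrite !step; set F := \poly_(i < _) f i; set G := \poly_(i < _) g i.
set H := \poly_(i < _) h i; by have -> : G * H * F = F * G * H by rewrite mulrC mulrA.
Qed.

Fact fps_mul1 : left_id fps_one fps_mul.
Proof.
move=> f; apply: fpsP => k; rewrite /= big_ord_recl /= subn0 mul1r big1 ?addr0//.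
by move=> i _; rewrite mul0r.
Qed.

Fact fps_mulDl : left_distributive fps_mul (@fps_add R).
Proof.
move=> f g h; apply: fpsP => k; rewrite /= -big_split /=.
by apply: eq_bigr => i _; rewrite mulrDl.
Qed.

Fact fps_one_neq0 : fps_one != 0.
Proof. by apply/eqP => /(congr1 (fun f : fps R => f 0%N)) /eqP; rewrite /= oner_eq0. Qed.

HB.instance Definition _ := GRing.Zmodule_isComNzRing.Build (fps R)
  fps_mulA fps_mulC fps_mul1 fps_mulDl fps_one_neq0.

Definition fpsX : fps R := Fps (fun k => (k == 1%N)%:R).

End FpsRing.

Arguments fpsX {R}.

Section FpsUnit.
Variable R : comUnitRingType.
Implicit Types f g : fps R.

Definition fps_unit : pred (fps R) := fun f => f 0%N \is a GRing.unit.

(* The first n coefficients of 1/f, solving f * (1/f) = 1 degree by degree. *)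
Fixpoint fps_inv_seq f n : seq R :=
  if n is m.+1 then
    let s := fps_inv_seq f m in
    rcons s ((f 0%N)^-1 * ((m == 0%N)%:R - \sum_(i < m) s`_i * f (m - i)%N))
  else [::].

(* Non-units are sent to themselves, as required of the inverse of a
   [unitRingType]. *)
Definition fps_inv f : fps R :=
  if fps_unit f then Fps (fun k => (fps_inv_seq f k.+1)`_k) else f.

Fact size_fps_inv_seq f n : size (fps_inv_seq f n) = n.
Proof. by elim: n => //= n IHn; rewrite size_rcons IHn. Qed.

Fact nth_fps_inv_seq f n k : (k < n)%N ->
  (fps_inv_seq f n)`_k = (fps_inv_seq f k.+1)`_k.
Proof.
elim: n => // n IHn; rewrite ltnS leq_eqVlt => /predU1P[-> //|kn].
by rewrite -(IHn kn) [in LHS]/= nth_rcons size_fps_inv_seq kn.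
Qed.

Fact fps_mulVx : {in fps_unit, left_inverse 1 fps_inv *%R}.
Proof.
move=> f uf; apply: fpsP => k; rewrite /fps_inv (uf : fps_unit f) /=.
rewrite big_ord_recr /= subnn nth_rcons size_fps_inv_seq ltnn eqxx.
rewrite [X in _ + X]mulrC mulVKr //.
rewrite [X in X + _](_ : _ = \sum_(i < k) (fps_inv_seq f k)`_i * f (k - i)%N).
  by rewrite addrC subrK.
by apply: eq_bigr => i _; congr (_ * _); rewrite [RHS]nth_fps_inv_seq.
Qed.

Fact fps_unitPl f g : g * f = 1 -> fps_unit f.
Proof.
move=> /(congr1 (fun h : fps R => h 0%N)) /=; rewrite big_ord1 => gf1.
by apply/unitrP; exists (g 0%N); rewrite [f 0%N * _]mulrC gf1.
Qed.

Fact fps_invr_out : {in [predC fps_unit], fps_inv =1 id}.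
Proof. by move=> f; rewrite inE /fps_inv => /negbTE; rewrite /in_mem /= => ->. Qed.

HB.instance Definition _ := GRing.ComNzRing_hasMulInverse.Build (fps R)
  fps_mulVx fps_unitPl fps_invr_out.

End FpsUnit.

(** * Limits, sums and products of series (coefficientwise stabilization) *)

Section FpsLimits.
Variable R : zmodType.

Definition fps_cvg (u : nat -> fps R) (f : fps R) :=
  forall k, exists N, forall n, (N <= n)%N -> u n k = f k.

(* Coefficients that do not stabilize are set to 0. *)
Definition fps_lim (u : nat -> fps R) : fps R :=
  Fps (fun k => xget 0
    [set c | exists N, forall n, (N <= n)%N -> u n k = c]%classic).

(* Unordered summation of a family over an arbitrary index type. *)
Definition fps_has_sum (T : choiceType) (u : T -> fps R) (f : fps R) :=
  forall k, exists J : {fset T}, forall K : {fset T},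
    (J `<=` K)%fset -> (\sum_(i <- K) u i) k = f k.

Lemma fps_cvg_lim (u : nat -> fps R) (f : fps R) :
  fps_cvg u f -> fps_lim u = f.
Proof.
move=> uf; apply: fpsP => k /=; apply: xget_unique; first exact: uf.
move=> c [N uN]; have [M uM] := uf k.
by rewrite -(uN (maxn N M)) ?leq_maxl// uM ?leq_maxr.
Qed.

Lemma fps_has_sum_unique (T : choiceType) (u : T -> fps R) (f g : fps R) :
  fps_has_sum u f -> fps_has_sum u g -> f = g.
Proof.
move=> uf ug; apply: fpsP => k; have [J uJ] := uf k; have [K uK] := ug k.
by rewrite -(uJ (J `|` K)%fset) ?fsubsetUl// uK ?fsubsetUr.
Qed.

End FpsLimits.

(** * q-shifted factorials *)

Section QPochhammer.
Variable R : comNzRingType.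
Implicit Types a b : fps R.

(* (a; b)_m *)
Definition qpoch a b (m : nat) : fps R := \prod_(j < m) (1 - a * b ^+ j).

(* (a; b)_oo *)
Definition qpoch_inf a b : fps R := fps_lim (qpoch a b).

(* (a_1, ..., a_s; b)_oo *)
Definition qpochs_inf (s : seq (fps R)) b : fps R :=
  \prod_(a <- s) qpoch_inf a b.

Lemma fps_expr_coef_lt b n k : b 0%N = 0 -> (k < n)%N -> (b ^+ n) k = 0.
Proof.
move=> b0; elim: n k => // n IHn k kn; rewrite exprSr /=.
apply: big1 => i _; have [ik|] := ltnP i n; first by rewrite IHn ?mul0r.
move=> ni; have -> : (k - i = 0)%N.
  by apply/eqP; rewrite subn_eq0 (leq_trans _ ni).
by rewrite b0 mulr0.
Qed.

Lemma qpoch_inf_cvg a b : b 0%N = 0 -> fps_cvg (qpoch a b) (qpoch_inf a b).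
Proof.
move=> b0; pose f := Fps (fun k => qpoch a b k.+1 k).
suff qf : fps_cvg (qpoch a b) f by rewrite /qpoch_inf (fps_cvg_lim qf).
move=> k; exists k.+1 => n; elim: n => // n IHn.
rewrite leq_eqVlt => /predU1P[[<-] //|]; rewrite ltnS => kn.
have -> : qpoch a b n.+1 = qpoch a b n - qpoch a b n * a * b ^+ n.
  by rewrite /qpoch big_ord_recr /= mulrBr mulr1 mulrA.
have subE (g h : fps R) : (g - h) k = g k - h k by [].
rewrite subE IHn // [X in _ - X](_ : _ = 0) ?subr0 //.
apply: big1 => i _; rewrite fps_expr_coef_lt ?mulr0 //.
exact: leq_ltn_trans (leq_subr _ _) kn.
Qed.

End QPochhammer.

(* Main.v *)
Require Import Defs.
From mathcomp Require Import all_boot all_order all_algebra.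
From mathcomp Require Import finmap.
From mathcomp Require Import zify ring.

(** The identity is an instance of Bailey's lemma.  A Bailey pair relative to
    a = 1 and to the base x is a pair of sequences with
<<
      beta_n = sum_(m <= n) alpha_m / ((x;x)_(n-m) (x;x)_(n+m)),
>>
    and [bailey_limit] says that then
<<
      sum_n x^(n^2) beta_n = (1 / (x;x)_oo) sum_m x^(m^2) alpha_m.
>>
    It remains to find the pair whose beta_n is the sum over r of the left
    hand side.  The lemma [base_change] turns a pair in base x^2 into a pair in
    base x, with
<<
      alpha'_(2m) = x^(2m^2) alpha_m,   alpha'_odd = 0,
      beta'_n = (1 / (x;x^2)_n) sum_r x^(2r^2) beta_r / (x;x)_(n-2r).
>>
    Apply it twice to the unit pair ([unit_pair]), where beta_n is 1 if n = 0
    and 0 otherwise, and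
<<
      alpha_k = (-1)^k x^(k(k-1)/2) (1 + x^k)   for k > 0.
>>
    From base q^4 to base q^2 it gives beta_r = 1/((q^2;q^2)_r (q^2;q^4)_r)
    ([slater_pair]), and from base q^2 to base q it gives the inner sum.  The
    exponents add up: the final alpha is supported on the multiples of 4, and
    at m = 4k the term q^(m^2) alpha_m is
<<
      (-1)^k q^(60 k(k-1)/2) (q^(28k) + q^(32k))
>>
    ([slater_alpha4]), so Jacobi's triple product in base q^60 evaluates the
    sum.

    Two finite sums do the work.  [qgauss_sum], a terminating q-Gauss sum in
    base x^2, is the kernel identity behind [base_change]; [qvandermonde_sum]
    is the one behind [bailey_lemma].  Both follow by induction from a
    two-term recurrence that comes from splitting
<<
      1 - x^N = (1 - x^(N-j)) + x^(N-j) (1 - x^j).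
>>
    The finite form [finite_jtp] of the triple product is itself a statement
    about a Bailey pair: it contains the unit pair as the case z = 1, and
    Jacobi's identity as a limit.  Limits are taken coefficientwise, and
    [tannery] exchanges them with sums. *)

Set Implicit Arguments.
Unset Strict Implicit.
Unset Printing Implicit Defensive.

Import GRing.Theory.
Local Open Scope ring_scope.

(** * Reciprocals of q-factorials *)

Section Pairs.
Variable R : comUnitRingType.
Implicit Types (x z w : fps R) (alpha beta : nat -> fps R) (k m n r s L M N : nat).

Lemma fps_unit1B (x : fps R) : x 0%N = 0 -> 1 - x \is a GRing.unit.
Proof.
move=> x0; rewrite [_ \is a _](_ : _ = ((1 - x) 0%N \is a GRing.unit)) //.
by rewrite /= x0 subr0 unitr1.
Qed.

Lemma fps_expr0 x n : x 0%N = 0 -> (x ^+ n.+1) 0%N = 0.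
Proof. by move=> x0; apply: fps_expr_coef_lt. Qed.

Lemma fps_mul0l x (f : fps R) : x 0%N = 0 -> (x * f) 0%N = 0.
Proof. by move=> x0; rewrite /= big_ord1 x0 mul0r. Qed.

Lemma qpochS (a b : fps R) n : qpoch a b n.+1 = qpoch a b n * (1 - a * b ^+ n).
Proof. by rewrite /qpoch big_ord_recr. Qed.

Lemma qpoch0 (a b : fps R) : qpoch a b 0 = 1.
Proof. by rewrite /qpoch big_ord0. Qed.

Lemma qpoch_unit (a b : fps R) n : a 0%N = 0 -> qpoch a b n \is a GRing.unit.
Proof.
move=> a0; rewrite /qpoch; elim/big_ind: _ => [|f g uf ug|i _].
- exact: unitr1.
- by rewrite unitrM uf.
- exact/fps_unit1B/fps_mul0l.
Qed.

Definition qfactV x n : fps R := (qpoch x x n)^-1.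

Lemma qfactV0 x : qfactV x 0 = 1.
Proof. by rewrite /qfactV qpoch0 invr1. Qed.

Lemma qfactVS x n : x 0%N = 0 -> qfactV x n = (1 - x ^+ n.+1) * qfactV x n.+1.
Proof.
move=> x0; have u := fps_unit1B (fps_expr0 n x0).
by rewrite /qfactV qpochS -exprS invrM ?qpoch_unit // mulVKr.
Qed.

(** The convention that the reciprocal of (x;x)_m is 0 for m < 0 lets every sum
    below run over a range that does not depend on the inner index. *)
Definition qfactVB x n k : fps R := if (k <= n)%N then qfactV x (n - k) else 0.

Lemma qfactVB_gt x n k : (n < k)%N -> qfactVB x n k = 0.
Proof. by rewrite /qfactVB ltnNge => /negbTE ->. Qed.

Lemma qfactVB_addr x n k : qfactVB x (n + k) k = qfactV x n.
Proof. by rewrite /qfactVB leq_addl addnK. Qed.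

Lemma qfactVB0 x n : qfactVB x n 0 = qfactV x n.
Proof. by rewrite /qfactVB subn0. Qed.

Lemma qfactVB_shift x n k : qfactVB x n.+1 k.+1 = qfactVB x n k.
Proof. by rewrite /qfactVB ltnS subSS. Qed.

(** * Two terminating summations *)

(** At k = n.+1 the first term on the right is 0 and the factor 1 - x ^+ k does
    the work; beyond, all terms vanish, so that truncated subtraction is
    harmless. *)
Lemma qfactVB_rec x n k : x 0%N = 0 ->
  (1 - x ^+ n.+1) * qfactVB x n.+1 k =
  qfactVB x n k + x ^+ (n.+1 - k) * (1 - x ^+ k) * qfactVB x n.+1 k.
Proof.
move=> x0; rewrite /qfactVB; case: (ltngtP k n.+1) => [kn|kn|->].
- rewrite -[(k <= n)%N]ltnS kn (qfactVS (n - k) x0) -subSn //.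
  have {1}-> : n.+1 = (n.+1 - k + k)%N by lia.
  by rewrite exprD; ring.
- have -> : (k <= n)%N = false by lia.
  by rewrite !mulr0 addr0.
- by rewrite ltnn subnn expr0; ring.
Qed.

Let termwise (a b c u d d' e : fps R) : u * d = d' + e ->
  u * (a * d * b * c) = a * d' * b * c + a * b * c * e.
Proof.
move=> ude; have -> : u * (a * d * b * c) = a * b * c * (u * d) by ring.
by rewrite ude; ring.
Qed.

(** The q-Gauss sum 2phi1(x^-N, x^(1-N); x^(2M+2); x^2, x^(2M+2N+1)), freed of
    negative powers.  Calling it T(N, M), [qfactVB_rec] with k = 2s and the shift
    s -> s + 1 in the second part give
    (1 - x^N) T(N, M) = T(N-1, M) + x^(N+2M) T(N-2, M+1). *)
Lemma qgauss_sum x M N L : x 0%N = 0 -> (N < 2 * L)%N ->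
  \sum_(s < L) x ^+ (2 * s ^ 2 + 2 * M * s) * qfactVB x N (2 * s)
     * qfactV (x ^+ 2) s * qfactV (x ^+ 2) (s + M)
  = qpoch x (x ^+ 2) (N + M) * qfactV x N * qfactV x (N + 2 * M).
Proof.
move=> x0.
have y0 : (x ^+ 2) 0%N = 0 by exact: fps_expr0.
(* (x;x)_(2m) = (x;x^2)_m (x^2;x^2)_m, which settles N = 0 and N = 1. *)
have qfactV2 m : qfactV (x ^+ 2) m = qpoch x (x ^+ 2) m * qfactV x (2 * m).
  elim: m => [|m IHm]; first by rewrite muln0 !qfactV0 qpoch0 mulr1.
  have u := fps_unit1B (fps_expr0 m y0).
  apply: (mulrI u); rewrite -qfactVS // IHm qpochS mulnS (qfactVS (2 * m) x0).
  rewrite (qfactVS (2 * m).+1 x0) -!exprM mulnS !add2n !(exprS x).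
  set e := x ^+ (2 * m); ring.
have one (N' L' M' : nat) : (N' < 2)%N -> (0 < L')%N ->
    \sum_(s < L') x ^+ (2 * s ^ 2 + 2 * M' * s) * qfactVB x N' (2 * s)
     * qfactV (x ^+ 2) s * qfactV (x ^+ 2) (s + M') = qfactV x N' * qfactV (x ^+ 2) M'.
  case: L' => // L' N2 _; rewrite big_ord_recl big1 => [|i _].
    by rewrite qfactVB0 !muln0 expr0 qfactV0 add0n !mul1r mulr1 addr0.
  by rewrite lift0 qfactVB_gt ?mulr0 ?mul0r //; lia.
elim/ltn_ind: N M L => -[|[|N]] IH M L NL.
- have L0 : (0 < L)%N by lia.
  by rewrite one // qfactV2 !add0n qfactV0; ring.
- have L0 : (0 < L)%N by lia.
  rewrite one //.
  rewrite qfactV2 add1n qpochS [in RHS](addnC 1%N) addn1 (qfactVS (2 * M) x0).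
  by rewrite -exprM -exprS mulnC; ring.
case: L NL => // L NL.
have u := fps_unit1B (fps_expr0 N.+1 x0).
apply: (mulrI u); rewrite mulr_sumr.
(* f gives T(N.+1, M), and h becomes a multiple of g, the summand of
   T(N, M.+1), after the shift of s. *)
pose f s := x ^+ (2 * s ^ 2 + 2 * M * s) * qfactVB x N.+1 (2 * s)
     * qfactV (x ^+ 2) s * qfactV (x ^+ 2) (s + M).
pose g s := x ^+ (2 * s ^ 2 + 2 * M.+1 * s) * qfactVB x N (2 * s)
     * qfactV (x ^+ 2) s * qfactV (x ^+ 2) (s + M.+1).
pose h s := x ^+ (2 * s ^ 2 + 2 * M * s) * qfactV (x ^+ 2) s * qfactV (x ^+ 2) (s + M)
  * (x ^+ (N.+2 - 2 * s) * (1 - x ^+ (2 * s)) * qfactVB x N.+2 (2 * s)).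
rewrite (eq_bigr (fun s : 'I_L.+1 => f s + h s)); last first.
  by move=> s _; apply: termwise; apply: qfactVB_rec.
rewrite big_split /= /f IH //; last lia.
rewrite big_ord_recl {1}/h muln0 expr0 subrr mulr0 mul0r mulr0 add0r.
rewrite (eq_bigr (fun s : 'I_L => x ^+ (N.+2 + 2 * M) * g s)); last first.
  move=> s _; rewrite /h /g lift0 (qfactVS s y0) -exprM addSnnS.
  have -> : (2 * s.+1 = (2 * s).+2)%N by lia.
  rewrite !qfactVB_shift.
  rewrite /qfactVB; case: leqP => [sN|_]; last by rewrite !(mulr0, mul0r).
  have -> : (2 * s.+1 ^ 2 + 2 * M * s.+1 =
     2 * s ^ 2 + 2 * M.+1 * s + 2 * s + 2 + 2 * M)%N by rewrite -!mulnn; lia.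
  have -> : (N.+2 + 2 * M = 2 * s + (N.+2 - (2 * s).+2) + 2 + 2 * M)%N by lia.
  by rewrite !exprD; ring.
rewrite -mulr_sumr /g IH //; last lia.
rewrite !addSn (_ : N + 2 * M.+1 = (N + 2 * M).+2)%N; last lia.
rewrite addnS !qpochS (qfactVS N x0) (qfactVS N.+1 x0) (qfactVS (N + 2 * M).+1 x0).
by rewrite -!exprM !mulnS !exprS !exprD; ring.
Qed.

(** A limiting case of the q-Chu-Vandermonde sum, by the same argument: here the
    recurrence is (1 - x^N) T(N, M) = T(N-1, M) + x^(N+M) T(N-1, M+1). *)
Lemma qvandermonde_sum x M N : x 0%N = 0 ->
  \sum_(s < N.+1) x ^+ (s ^ 2 + M * s) * qfactVB x N s * qfactV x s * qfactV x (s + M)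
  = qfactV x N * qfactV x (N + M).
Proof.
move=> x0; elim: N M => [|N IH] M.
  by rewrite big_ord_recl big_ord0 qfactVB0 !muln0 expr0 qfactV0 !add0n addr0 !mul1r.
have u := fps_unit1B (fps_expr0 N x0).
apply: (mulrI u); rewrite mulr_sumr.
pose f s := x ^+ (s ^ 2 + M * s) * qfactVB x N s * qfactV x s * qfactV x (s + M).
pose g s := x ^+ (s ^ 2 + M.+1 * s) * qfactVB x N s * qfactV x s * qfactV x (s + M.+1).
pose h s := x ^+ (s ^ 2 + M * s) * qfactV x s * qfactV x (s + M)
  * (x ^+ (N.+1 - s) * (1 - x ^+ s) * qfactVB x N.+1 s).
rewrite (eq_bigr (fun s : 'I_N.+2 => f s + h s)); last first.
  by move=> s _; apply: termwise; apply: qfactVB_rec.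
rewrite big_split /= big_ord_recr /= {2}/f qfactVB_gt // mulr0 !mul0r addr0 IH.
rewrite big_ord_recl {1}/h expr0 subrr mulr0 mul0r mulr0 add0r.
rewrite (eq_bigr (fun s : 'I_N.+1 => x ^+ (N.+1 + M) * g s)); last first.
  move=> s _; rewrite /h /g lift0 qfactVB_shift (qfactVS s x0) addSnnS.
  have sN := ltn_ord s.
  have -> : (s.+1 ^ 2 + M * s.+1 = s ^ 2 + M.+1 * s + s + 1 + M)%N.
    by rewrite -!mulnn; lia.
  have -> : (N.+1 + M = s + (N.+1 - s.+1) + 1 + M)%N by lia.
  by rewrite !exprD; ring.
rewrite -mulr_sumr /g IH addnS (qfactVS N x0) addSn (qfactVS (N + M) x0) !exprS exprD.
by ring.
Qed.

(** * Bailey pairs *)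

Definition bailey_pair x alpha beta :=
  forall n, beta n = \sum_(m < n.+1) alpha m * qfactVB x n m * qfactV x (n + m).

Lemma bailey_pair_wide x alpha beta n L : bailey_pair x alpha beta ->
  (n < L)%N -> beta n = \sum_(m < L) alpha m * qfactVB x n m * qfactV x (n + m).
Proof.
move=> ab nL; rewrite ab.
rewrite (big_ord_widen _ (fun m => alpha m * qfactVB x n m * qfactV x (n + m)) nL).
rewrite big_mkcond; apply: eq_bigr => m _; case: ltnP => // nm.
by rewrite qfactVB_gt // mulr0 mul0r.
Qed.

(** Bailey's transform, an exchange of summations: [bailey_lemma] and
    [base_change] each choose a gamma whose sum against the kernel is known. *)
Lemma bailey_transform x alpha beta (gamma delta : nat -> fps R) L :
  bailey_pair x alpha beta ->
  (forall m, (m < L)%N ->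
     \sum_(r < L) gamma r * qfactVB x r m * qfactV x (r + m) = delta m) ->
  \sum_(r < L) gamma r * beta r = \sum_(m < L) alpha m * delta m.
Proof.
move=> ab gd.
under eq_bigr => r _ do rewrite (bailey_pair_wide ab (ltn_ord r)) mulr_sumr.
rewrite exchange_big; apply: eq_bigr => m _ /=.
rewrite -gd // mulr_sumr; apply: eq_bigr => r _; ring.
Qed.

Lemma sum_qfactVB_shift x (f : nat -> fps R) m L : (m <= L)%N ->
  \sum_(r < L) f r * qfactVB x r m * qfactV x (r + m) =
  \sum_(s < L - m) f (s + m)%N * qfactV x s * qfactV x (s + 2 * m).
Proof.
move=> mL; rewrite -!(big_mkord xpredT (fun r => f r * qfactVB x r m * qfactV x (r + m))).
rewrite (big_cat_nat _ mL) //= [X in X + _]big1_seq ?add0r; last first.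
  move=> r; rewrite mem_index_iota /= => rm.
  by rewrite qfactVB_gt // mulr0 mul0r.
rewrite -{1}(add0n m) big_addn big_mkord; apply: eq_bigr => s _.
by rewrite qfactVB_addr -addnA addnn -mul2n.
Qed.

(** The kernel identity is [qvandermonde_sum] for N = n - m and M = 2m, after
    the shift r = s + m. *)
Lemma bailey_lemma x alpha beta : x 0%N = 0 -> bailey_pair x alpha beta ->
  bailey_pair x (fun m => x ^+ (m ^ 2) * alpha m)
    (fun n => \sum_(r < n.+1) x ^+ (r ^ 2) * qfactVB x n r * beta r).
Proof.
move=> x0 ab n.
rewrite (bailey_transform (gamma := fun r => x ^+ (r ^ 2) * qfactVB x n r)
  (delta := fun m => x ^+ (m ^ 2) * qfactVB x n m * qfactV x (n + m)) ab).
  by apply: eq_bigr => m _; ring.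
move=> m mn.
rewrite (@sum_qfactVB_shift x (fun r => x ^+ (r ^ 2) * qfactVB x n r)) 1?ltnW //.
have [N ->] : exists N, n = (N + m)%N by exists (n - m)%N; lia.
rewrite -addSn addnK qfactVB_addr.
transitivity (x ^+ (m ^ 2) * \sum_(s < N.+1) x ^+ (s ^ 2 + (2 * m) * s) * qfactVB x N s
   * qfactV x s * qfactV x (s + 2 * m)).
  rewrite mulr_sumr; apply: eq_bigr => s _.
  have -> : qfactVB x (N + m) (s + m) = qfactVB x N s by rewrite /qfactVB leq_add2r subnDr.
  have -> : ((s + m) ^ 2 = m ^ 2 + (s ^ 2 + (2 * m) * s))%N by rewrite -!mulnn; lia.
  by rewrite exprD; ring.
by rewrite qvandermonde_sum // -addnA addnn -mul2n mulrA.
Qed.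

(** The effect of [base_change] on alpha. *)
Definition dilate x alpha m :=
  if odd m then 0 else x ^+ (2 * m./2 ^ 2) * alpha m./2.

Lemma dilate_double x alpha m : dilate x alpha (2 * m) = x ^+ (2 * m ^ 2) * alpha m.
Proof. by rewrite /dilate mul2n odd_double doubleK. Qed.

Lemma sum_even (f : nat -> fps R) L : (forall m, odd m -> f m = 0) ->
  \sum_(j < 2 * L) f j = \sum_(m < L) f (2 * m)%N.
Proof.
move=> f0; elim: L => [|L IH]; first by rewrite !big_ord0.
rewrite mulnS add2n !big_ord_recr /= IH [f (2 * L).+1]f0 ?addr0 //.
by rewrite oddS mul2n odd_double.
Qed.

(** The kernel identity is [qgauss_sum] for N = n - 2m and M = 2m, after the
    shift r = s + m. *)
Lemma base_change x alpha beta : x 0%N = 0 -> bailey_pair (x ^+ 2) alpha beta ->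
  bailey_pair x (dilate x alpha)
    (fun n => (qpoch x (x ^+ 2) n)^-1 *
       \sum_(r < n.+1) x ^+ (2 * r ^ 2) * qfactVB x n (2 * r) * beta r).
Proof.
move=> x0 ab n; have u := qpoch_unit (x ^+ 2) n x0.
have y0 : (x ^+ 2) 0%N = 0 by exact: fps_expr0.
rewrite (bailey_transform (gamma := fun r => x ^+ (2 * r ^ 2) * qfactVB x n (2 * r))
  (delta := fun m => qpoch x (x ^+ 2) n *
     (x ^+ (2 * m ^ 2) * qfactVB x n (2 * m) * qfactV x (n + 2 * m))) ab).
  have E : \sum_(m < n.+1) dilate x alpha m * qfactVB x n m * qfactV x (n + m)
     = \sum_(m < 2 * n.+1) dilate x alpha m * qfactVB x n m * qfactV x (n + m).
    have le : (n.+1 <= 2 * n.+1)%N by lia.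
    rewrite (big_ord_widen _ (fun m => dilate x alpha m * qfactVB x n m * qfactV x (n + m)) le).
    rewrite big_mkcond; apply: eq_bigr => m _; case: ltnP => // nm.
    by rewrite qfactVB_gt // mulr0 mul0r.
  rewrite E (sum_even (f := fun m => dilate x alpha m * qfactVB x n m * qfactV x (n + m))).
    rewrite mulr_sumr; apply: eq_bigr => m _; rewrite dilate_double.
    by rewrite [alpha m * _]mulrCA mulKr //; ring.
  by move=> m om; rewrite /dilate om !mul0r.
move=> m mn.
rewrite (@sum_qfactVB_shift _ (fun r => x ^+ (2 * r ^ 2) * qfactVB x n (2 * r))) 1?ltnW //.
case: (leqP (2 * m) n) => [mn2|nm]; last first.
  rewrite [qfactVB x n (2 * m)]qfactVB_gt // mulr0 mul0r mulr0 big1 // => s _.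
  by rewrite qfactVB_gt ?mulr0 ?mul0r //; lia.
have [N nE] : exists N, n = (N + 2 * m)%N by exists (n - 2 * m)%N; lia.
rewrite nE qfactVB_addr.
transitivity (x ^+ (2 * m ^ 2) * \sum_(s < n.+1 - m) x ^+ (2 * s ^ 2 + 2 * (2 * m) * s)
   * qfactVB x N (2 * s) * qfactV (x ^+ 2) s * qfactV (x ^+ 2) (s + 2 * m)).
  rewrite mulr_sumr nE; apply: eq_bigr => s _.
  have -> : qfactVB x (N + 2 * m) (2 * (s + m)) = qfactVB x N (2 * s).
    by rewrite mulnDr /qfactVB leq_add2r subnDr.
  have -> : (2 * (s + m) ^ 2 = 2 * m ^ 2 + (2 * s ^ 2 + 2 * (2 * m) * s))%N.
    by rewrite -!mulnn; lia.
  by rewrite exprD; ring.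
rewrite qgauss_sum //; last lia.
by rewrite -[(N + 2 * m + 2 * m)%N]addnA addnn -mul2n; ring.
Qed.

(** * The finite Jacobi triple product *)

Lemma qfactVBS x n k : x 0%N = 0 -> (k <= n)%N ->
  qfactVB x n k.+1 = (1 - x ^+ (n - k)) * qfactVB x n k.
Proof.
move=> x0; rewrite leq_eqVlt => /predU1P[->|kn].
  by rewrite qfactVB_gt // subnn expr0 subrr mul0r.
rewrite /qfactVB kn (ltnW kn) (qfactVS _ x0); have -> : (n - k.+1).+1 = (n - k)%N by lia.
by [].
Qed.

(** The two-sided theta series sum_(k in Z) (-1)^k x^(k(k-1)/2) z^k is folded at
    k = 0: when z w = x, its term of index -k is [theta_half x w k].  This avoids
    negative powers of z. *)
Definition theta_half x z k := (-1) ^+ k * x ^+ 'C(k, 2) * z ^+ k.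

Definition theta x z w k :=
  if k is 0%N then 1 else theta_half x z k + theta_half x w k.

Lemma theta_half0 x z : theta_half x z 0 = 1.
Proof. by rewrite /theta_half !expr0 !mul1r. Qed.

Lemma theta_halfS x z k : theta_half x z k.+1 = - (x ^+ k * z * theta_half x z k).
Proof. by rewrite /theta_half binS bin1 exprD !exprS; ring. Qed.

(* The kernel of Bailey pairs, and the ratio (x;x)_(2n+2) / (x;x)_(2n). *)
Let d x n k := qfactVB x n k * qfactV x (n + k).

Let c x n := (1 - x ^+ (2 * n).+1) * (1 - x ^+ (2 * n).+2).

(** The q-Pascal rule for central Gaussian binomials, applied twice; at k = 0
    the two neighbours k - 1 and k + 1 coincide by symmetry. *)
Lemma pascal0 x n : x 0%N = 0 ->
  c x n * d x n.+1 0 = (1 + x ^+ (2 * n).+1) * d x n 0 + x ^+ n.+1 * d x n 1 *+ 2.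
Proof.
move=> x0; rewrite /d /c qfactVBS // !qfactVB0 !addn0 addn1 subn0 (qfactVS n x0).
by rewrite mul2n -addnn !exprS !exprD; ring.
Qed.

Lemma pascalS x n k : x 0%N = 0 -> (k <= n)%N ->
  c x n * d x n.+1 k.+1 = (1 + x ^+ (2 * n).+1) * d x n k.+1
    + x ^+ (n - k) * d x n k + x ^+ (n + k).+2 * d x n k.+2.
Proof.
move=> x0 kn; rewrite /d /c qfactVB_shift.
rewrite !addnS !addSn (qfactVS (n + k) x0) (qfactVS (n + k).+1 x0).
move: kn; rewrite leq_eqVlt => /predU1P[->|kn].
  rewrite subnn expr0 [qfactVB x n n.+1]qfactVB_gt //
    [qfactVB x n n.+2]qfactVB_gt // addnn -mul2n !exprS.
  by ring.
rewrite (qfactVBS x0 kn) (qfactVBS x0 (ltnW kn)).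
have -> : (n - k = (n - k.+1).+1)%N by lia.
have -> : (2 * n = (n - k.+1).+1 + (n + k))%N by lia.
by rewrite addSn !exprS !exprD; ring.
Qed.

(* The half k >= 0 of the theta sum. *)
Let G x z n := \sum_(k < n.+1) theta_half x z k * d x n k.

Let G_recl x z n :
  G x z n = d x n 0 + \sum_(k < n) theta_half x z k.+1 * d x n k.+1.
Proof.
by rewrite /G big_ord_recl theta_half0 mul1r.
Qed.

(** Multiplying the half sum by z or by w shifts its index, and [pascalS]
    recombines the terms.  The last two terms on the right are what the shift
    leaves at k = 0; [pascal0] absorbs them when the halves in z and in w are
    added and the term k = 0, counted twice, is subtracted once. *)
Lemma theta_step x z w n : x 0%N = 0 -> z * w = x ->
  (1 - z * x ^+ n) * (1 - w * x ^+ n) * G x z n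
  = c x n * G x z n.+1 - x ^+ n.+1 * d x n 1 - x ^+ n * w * d x n 0.
Proof.
move=> x0 zw.
have dn1 k : (n < k)%N -> d x n k = 0 by move=> nk; rewrite /d qfactVB_gt ?mul0r.
pose A := \sum_(k < n.+1) theta_half x z k.+1 * d x n k.+1.
pose B := \sum_(k < n.+1) x ^+ (n - k) * theta_half x z k.+1 * d x n k.
pose C := \sum_(k < n.+1) x ^+ (n + k).+2 * theta_half x z k.+1 * d x n k.+2.
have E1 : G x z n = d x n 0 + A.
  by rewrite G_recl /A big_ord_recr /= [d x n n.+1]dn1 // mulr0 addr0.
have E2 : x ^+ n * z * G x z n = - B.
  rewrite /G /B mulr_sumr -sumrN; apply: eq_bigr => k _; rewrite theta_halfS.
  by have {1}-> : n = (n - k + k)%N by [have := ltn_ord k; lia]; rewrite exprD; ring.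
have E3 : x ^+ n * w * G x z n = x ^+ n * w * d x n 0 - x ^+ n.+1 * d x n 1 - C.
  rewrite E1 mulrDr -addrA; congr (_ + _).
  rewrite /A /C [in RHS]big_ord_recr /= [d x n n.+2]dn1 // mulr0 addr0.
  rewrite big_ord_recl theta_halfS theta_half0 mulrDr; congr (_ + _).
    by rewrite -{2}zw !exprS -{3}zw; ring.
  rewrite mulr_sumr -sumrN; apply: eq_bigr => k _; rewrite lift0.
  have -> : x ^+ (n + k).+2 = x ^+ n * x ^+ k.+1 * (z * w).
    by rewrite zw -exprD -exprSr addnS.
  by rewrite [theta_half x z k.+2]theta_halfS; ring.
have E4 : c x n * G x z n.+1 = c x n * d x n.+1 0 + (1 + x ^+ (2 * n).+1) * A + B + C.
  rewrite G_recl mulrDr -!addrA; congr (_ + _).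
  rewrite /A /B /C !mulr_sumr -!big_split; apply: eq_bigr => k _.
  by rewrite /= mulrCA (pascalS (k := k) x0 (ltn_ord k)); ring.
rewrite E4 pascal0 //.
have -> : (1 - z * x ^+ n) * (1 - w * x ^+ n) * G x z n =
   (1 + x ^+ (2 * n).+1) * G x z n - x ^+ n * z * G x z n - x ^+ n * w * G x z n.
  have -> : x ^+ (2 * n).+1 = x ^+ n * x ^+ n * (z * w).
    by rewrite zw -exprD -exprSr addnn mul2n.
  ring.
by rewrite E2 E3 E1; ring.
Qed.

(** Both sides are multiplied by (1 - z x^n) (1 - w x^n) when n grows by 1, up to
    the normalisation by (x;x)_(2n). *)
Lemma finite_jtp x z w : x 0%N = 0 -> z * w = x ->
  bailey_pair x (theta x z w)
    (fun n => qpoch z x n * qpoch w x n * qfactV x (2 * n)).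
Proof.
move=> x0 zw.
have GE n : \sum_(k < n.+1) theta x z w k * qfactVB x n k * qfactV x (n + k)
    = G x z n + G x w n - d x n 0.
  rewrite !G_recl big_ord_recl mul1r addn0 -/(d x n 0).
  rewrite [X in _ = X - _](_ : _ = d x n 0 + (d x n 0 +
    \sum_(k < n) theta x z w k.+1 * d x n k.+1)).
    rewrite [RHS]addrC addKr /d addn0; congr (_ + _).
    by apply: eq_bigr => k _; rewrite mulrA.
  rewrite addrACA -addrA; congr (_ + (_ + _)); rewrite -big_split /=.
  by apply: eq_bigr => k _; rewrite /= -mulrDl.
elim=> [|n IH]; rewrite GE.
  have G0 u : G x u 0 = d x 0 0 by rewrite G_recl big_ord0 addr0.
  rewrite !G0 addrK qpoch0 qpoch0 /d qfactVB0.
  by rewrite !mul1r muln0 addn0 qfactV0 mul1r.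
have u : c x n \is a GRing.unit by rewrite unitrM !fps_unit1B // fps_expr0.
apply: (mulrI u); rewrite !qpochS mulnS add2n.
have -> : c x n * (qpoch z x n * (1 - z * x ^+ n) * (qpoch w x n * (1 - w * x ^+ n))
   * qfactV x (2 * n).+2) = (1 - z * x ^+ n) * (1 - w * x ^+ n) *
     (qpoch z x n * qpoch w x n * qfactV x (2 * n)).
  by rewrite /c (qfactVS (2 * n) x0) (qfactVS (2 * n).+1 x0); ring.
rewrite IH GE.
have E1 := theta_step n x0 zw.
have E2 : (1 - w * x ^+ n) * (1 - z * x ^+ n) * G x w n
  = c x n * G x w n.+1 - x ^+ n.+1 * d x n 1 - x ^+ n * z * d x n 0.
  by apply: theta_step; rewrite // mulrC.
have E3 := pascal0 n x0.
have xnn : x ^+ (2 * n).+1 = x ^+ n * x ^+ n * (z * w).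
  by rewrite zw -exprD -exprSr addnn mul2n.
have -> : (1 - z * x ^+ n) * (1 - w * x ^+ n) * (G x z n + G x w n - d x n 0) =
   (1 - z * x ^+ n) * (1 - w * x ^+ n) * G x z n +
   (1 - w * x ^+ n) * (1 - z * x ^+ n) * G x w n -
   (1 + x ^+ (2 * n).+1 - z * x ^+ n - w * x ^+ n) * d x n 0.
  by rewrite xnn; move: (G x z n) (G x w n) (d x n 0) => a b e; ring.
rewrite E1 E2 mulrBr E3 xnn.
move: (c x n) (G x z n.+1) (G x w n.+1) (d x n 0) (d x n 1) => a b e f g; ring.
Qed.

End Pairs.

(** * Limits of power series *)

Section Limits.
Variable R : comUnitRingType.
Implicit Types (f g h x y z w : fps R) (u v a : nat -> fps R) (c : nat -> nat -> fps R).
Implicit Types (k m n r N : nat).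

Definition fps_eqmod n f g := forall k, (k < n)%N -> f k = g k.

Lemma fps_eqmod_sym n f g : fps_eqmod n f g -> fps_eqmod n g f.
Proof. by move=> fg k kn; rewrite fg. Qed.

Lemma fps_eqmod_trans n g f h :
  fps_eqmod n f g -> fps_eqmod n g h -> fps_eqmod n f h.
Proof. by move=> fg gh k kn; rewrite fg ?gh. Qed.

Lemma fps_eqmod_le m n f g : (m <= n)%N -> fps_eqmod n f g -> fps_eqmod m f g.
Proof. by move=> mn fg k km; apply: fg; apply: leq_trans mn. Qed.

Lemma fps_eqmodM n f g f' g' : fps_eqmod n f f' -> fps_eqmod n g g' ->
  fps_eqmod n (f * g) (f' * g').
Proof.
move=> ff gg k kn /=; apply: eq_bigr => i _.
have ik : (i <= k)%N by rewrite -ltnS.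
by rewrite ff ?gg // (leq_ltn_trans _ kn) ?leq_subr.
Qed.

Lemma fps_sumE (I : Type) (s : seq I) (P : pred I) (F : I -> fps R) k :
  (\sum_(i <- s | P i) F i) k = \sum_(i <- s | P i) F i k.
Proof. by apply: (big_morph (fun f : fps R => f k)). Qed.

Lemma fps_eqmod_sum n (I : Type) (s : seq I) (P : pred I) (F G : I -> fps R) :
  (forall i, P i -> fps_eqmod n (F i) (G i)) ->
  fps_eqmod n (\sum_(i <- s | P i) F i) (\sum_(i <- s | P i) G i).
Proof. by move=> FG k kn; rewrite !fps_sumE; apply: eq_bigr => i /FG; apply. Qed.

Lemma fps_eqmodV n f g : f \is a GRing.unit -> g \is a GRing.unit ->
  fps_eqmod n f g -> fps_eqmod n f^-1 g^-1.
Proof.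
move=> uf ug fg.
have -> : g^-1 = f^-1 * f / g by rewrite mulVr // mul1r.
rewrite -{1}[f^-1](mulrK ug).
by apply: fps_eqmodM => //; apply: fps_eqmodM => //; apply: fps_eqmod_sym.
Qed.

Lemma fps_cvgP u f : fps_cvg u f <->
  forall n, exists N, forall m, (N <= m)%N -> fps_eqmod n (u m) f.
Proof.
split=> [uf|uf k]; last first.
  by have [N uN] := uf k.+1; exists N => n /uN; apply.
elim=> [|n [N IH]]; first by exists 0%N.
have [M uM] := uf n; exists (maxn N M) => m; rewrite geq_max => /andP[Nm Mm] k.
by rewrite ltnS leq_eqVlt => /predU1P[->|]; [apply: uM | apply: IH].
Qed.

Lemma fps_cvg_comp u f (s : nat -> nat) :
  (forall N, exists M, forall n, (M <= n)%N -> (N <= s n)%N) ->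
  fps_cvg u f -> fps_cvg (fun n => u (s n)) f.
Proof.
move=> s_oo uf k; have [N uN] := uf k; have [M sM] := s_oo N.
by exists M => n /sM /uN.
Qed.

Lemma fps_cvgM u v f g : fps_cvg u f -> fps_cvg v g ->
  fps_cvg (fun n => u n * v n) (f * g).
Proof.
move=> /fps_cvgP uf /fps_cvgP vg; apply/fps_cvgP => n.
have [N uN] := uf n; have [M vM] := vg n; exists (maxn N M) => m.
by rewrite geq_max => /andP[/uN uM /vM]; apply: fps_eqmodM.
Qed.

Lemma fps_cvg_unit u f : (forall n, u n \is a GRing.unit) -> fps_cvg u f ->
  f \is a GRing.unit.
Proof.
move=> uu /(_ 0%N)[N uN].
by rewrite [f \is a _](_ : _ = (f 0%N \is a GRing.unit)) // -(uN N) //; apply: uu.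
Qed.

Lemma fps_cvgV u f : (forall n, u n \is a GRing.unit) -> fps_cvg u f ->
  fps_cvg (fun n => (u n)^-1) f^-1.
Proof.
move=> uu uf; have ff := fps_cvg_unit uu uf; move/fps_cvgP: uf => uf.
by apply/fps_cvgP => n; have [N uN] := uf n; exists N => m /uN; apply: fps_eqmodV.
Qed.

Lemma fps_cvg_unique u f g : fps_cvg u f -> fps_cvg u g -> f = g.
Proof. by move=> /fps_cvg_lim <- /fps_cvg_lim <-. Qed.

(** * Series *)

(** The sum of the series when a k has order at least k, since then the later
    terms do not reach the coefficient k. *)
Definition fps_series a : fps R := Fps (fun k => (\sum_(i < k.+1) a i) k).

Definition summable_fps a := forall k, fps_eqmod k (a k) 0.

Lemma summable_pow x a : x 0%N = 0 -> summable_fps (fun k => x ^+ k * a k).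
Proof.
move=> x0 k j jk /=; apply: big1 => i _.
by rewrite fps_expr_coef_lt ?mul0r // (leq_ltn_trans _ jk) // -ltnS.
Qed.

Lemma summable_square x a : x 0%N = 0 ->
  summable_fps (fun n => x ^+ (n ^ 2) * a n).
Proof.
move=> x0 n; have -> : (n ^ 2 = n + (n ^ 2 - n))%N by rewrite -mulnn; nia.
rewrite exprD -mulrA.
exact: (summable_pow (fun n => x ^+ (n ^ 2 - n) * a n)).
Qed.

Lemma sum_trunc (F : nat -> fps R) n N : (n <= N)%N ->
  (forall k, (n <= k)%N -> fps_eqmod n (F k) 0) ->
  fps_eqmod n (\sum_(k < N) F k) (\sum_(k < n) F k).
Proof.
move=> nN F0; rewrite (big_ord_widen _ F nN) [X in fps_eqmod _ _ X]big_mkcond.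
by apply: fps_eqmod_sum => k _; case: ltnP => // /F0.
Qed.

Lemma fps_series_trunc a n N : summable_fps a -> (n <= N)%N ->
  fps_eqmod n (\sum_(k < N) a k) (fps_series a).
Proof.
move=> sa nN j jn; apply: (sum_trunc (n := j.+1)) => [||//].
  exact: leq_trans nN.
by move=> k jk; apply: fps_eqmod_le (sa k).
Qed.

(** Modulo x^n only the terms k < n of either side matter, and for these
    finitely many k the convergence of c is uniform. *)
Lemma tannery a c l : summable_fps a -> (forall k, fps_cvg (c^~ k) l) ->
  fps_cvg (fun N => \sum_(k < N.+1) a k * c N k) (fps_series a * l).
Proof.
move=> sa cl; apply/fps_cvgP => n.
have [M cM] : exists M, forall k N, (k < n)%N -> (M <= N)%N -> fps_eqmod n (c N k) l.
  elim: {-2}n => [|m [M IH]]; first by exists 0%N.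
  have /fps_cvgP/(_ n)[M' cM'] := cl m; exists (maxn M M') => k N.
  rewrite ltnS leq_eqVlt geq_max => /predU1P[->|km] /andP[MN MN'].
    exact: cM'.
  exact: IH.
exists (maxn n M) => N; rewrite geq_max => /andP[nN MN].
apply: (@fps_eqmod_trans _ (\sum_(k < n) a k * c N k)).
  apply: (sum_trunc (F := fun k => a k * c N k)); first exact: leqW.
  move=> k nk; rewrite -(mul0r (c N k)); apply: fps_eqmodM => //.
  exact: fps_eqmod_le (sa k).
apply: (@fps_eqmod_trans _ (\sum_(k < n) a k * l)).
  by apply: fps_eqmod_sum => k _; apply: fps_eqmodM => //; apply: cM.
by rewrite -mulr_suml; apply: fps_eqmodM => //; apply: fps_series_trunc.
Qed.

(** The coefficient k sees only the indices in the square n, r <= k, so any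
    finite set that contains this square gives the same coefficient. *)
Lemma triangle_has_sum (u : nat * nat -> fps R) :
  (forall n r, (n < r)%N -> u (n, r) = 0) ->
  (forall n r, fps_eqmod n (u (n, r)) 0) ->
  fps_has_sum u (fps_series (fun n => \sum_(r < n.+1) u (n, val r))).
Proof.
move=> u0 un k.
pose s := [seq (n, r) | n <- iota 0 k.+1, r <- iota 0 k.+1].
exists (seq_fset tt s) => K sK.
rewrite [LHS]fps_sumE -(big_fset_incl _ sK) => [|[n r] _]; last first.
  rewrite seq_fsetE => nrs; case: (ltnP k n) => [kn|nk]; first by rewrite (un _ _ _ kn).
  rewrite u0 //; rewrite ltnNge; apply: contra nrs => rn.
  by apply: allpairs_f; rewrite mem_iota ltnS ?(leq_trans rn).
rewrite (perm_big s); last first.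
  rewrite (permPl (seq_fset_perm _ _)) undup_id //.
  by apply: allpairs_uniq; rewrite ?iota_uniq // => -[? ?] [? ?].
rewrite -fps_sumE big_allpairs -[iota _ _]/(index_iota 0 k.+1) big_mkord.
rewrite [RHS]/= !fps_sumE; apply: eq_bigr => n _; rewrite big_mkord.
rewrite (big_ord_widen _ (fun r => u (nat_of_ord n, r)) (ltn_ord n)).
rewrite [in RHS]big_mkcond; congr (fps_coef _ k); apply: eq_bigr => r _.
by case: ltnP => // nr; rewrite u0.
Qed.

(** * Infinite products and the limit of Bailey's lemma *)

Lemma qpoch_inf_unit x y : x 0%N = 0 -> y 0%N = 0 -> qpoch_inf x y \is a GRing.unit.
Proof.
move=> x0 y0; apply: fps_cvg_unit (qpoch_inf_cvg x y0) => n.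
exact: qpoch_unit.
Qed.

Lemma qfactV_cvg x : x 0%N = 0 -> fps_cvg (qfactV x) (qpoch_inf x x)^-1.
Proof.
by move=> x0; apply: fps_cvgV (qpoch_inf_cvg x x0) => n; apply: qpoch_unit.
Qed.

Lemma qfactVB_cvg x k : x 0%N = 0 -> fps_cvg ((qfactVB x)^~ k) (qpoch_inf x x)^-1.
Proof.
move=> x0 j.
have subk N : exists M, forall n, (M <= n)%N -> (N <= n - k)%N.
  by exists (N + k)%N => n; lia.
have [N dN] := fps_cvg_comp subk (qfactV_cvg x0) j.
exists (maxn N k) => n; rewrite geq_max => /andP[Nn kn].
by rewrite /qfactVB kn dN.
Qed.

Lemma bailey_kernel_cvg x k : x 0%N = 0 ->
  fps_cvg (fun n => qfactVB x n k * qfactV x (n + k))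
    ((qpoch_inf x x)^-1 * (qpoch_inf x x)^-1).
Proof.
move=> x0; apply: fps_cvgM; first exact: qfactVB_cvg.
apply: (fps_cvg_comp (u := qfactV x)); last exact: qfactV_cvg.
by move=> N; exists N => n; lia.
Qed.

(** The limit of [bailey_lemma]: its left side tends to the series in beta over
    (x;x)_oo, and its right side to the series in alpha over the square of
    (x;x)_oo. *)
Lemma bailey_limit x alpha beta : x 0%N = 0 -> bailey_pair x alpha beta ->
  fps_series (fun n => x ^+ (n ^ 2) * beta n) =
  fps_series (fun m => x ^+ (m ^ 2) * alpha m) / qpoch_inf x x.
Proof.
move=> x0 /(bailey_lemma x0) ab; set i := (qpoch_inf x x)^-1.
have ui : i \is a GRing.unit by rewrite unitrV qpoch_inf_unit.
apply: (mulIr ui); rewrite -mulrA.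
apply: (@fps_cvg_unique (fun n => \sum_(r < n.+1) x ^+ (r ^ 2) * qfactVB x n r * beta r)).
  under [fun n => _]boolp.funext => n do under eq_bigr => r _ do rewrite mulrAC.
  apply: tannery => [|k]; first exact: summable_square.
  exact: qfactVB_cvg.
under [fun n => _]boolp.funext => n do (rewrite ab; under eq_bigr => r _ do rewrite -mulrA).
apply: (tannery (c := fun n k => qfactVB x n k * qfactV x (n + k))) => [|k].
  exact: summable_square.
exact: bailey_kernel_cvg.
Qed.

Lemma summable_theta x z w : z 0%N = 0 -> w 0%N = 0 -> summable_fps (theta x z w).
Proof.
move=> z0 w0 [|k] // j jk.
have half (t : fps R) : t 0%N = 0 -> theta_half x t k.+1 j = 0.
  by move=> t0; rewrite /theta_half mulrC; apply: (summable_pow (fun k => _)).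
change (theta_half x z k.+1 j + theta_half x w k.+1 j = 0).
by rewrite (half z z0) (half w w0) addr0.
Qed.

(** The limit of [finite_jtp], whose kernel tends to the inverse square of
    (x;x)_oo, and its right side to (z;x)_oo (w;x)_oo / (x;x)_oo. *)
Lemma jacobi_triple_product x z w : z 0%N = 0 -> w 0%N = 0 -> z * w = x ->
  fps_series (theta x z w) = qpoch_inf z x * qpoch_inf w x * qpoch_inf x x.
Proof.
move=> z0 w0 zw; have x0 : x 0%N = 0 by rewrite -zw fps_mul0l.
set p := qpoch_inf x x.
have up : p \is a GRing.unit by rewrite qpoch_inf_unit.
have ui : p^-1 \is a GRing.unit by rewrite unitrV.
apply: (mulIr ui); apply: (mulIr ui); rewrite mulrK // -mulrA.
apply: (@fps_cvg_unique (fun n => qpoch z x n * qpoch w x n * qfactV x (2 * n))).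
  under [fun n => _]boolp.funext => n do
    (rewrite (finite_jtp x0 zw); under eq_bigr => r _ do rewrite -mulrA).
  apply: (tannery (c := fun n k => qfactVB x n k * qfactV x (n + k))) => [|k].
    exact: summable_theta.
  exact: bailey_kernel_cvg.
apply: fps_cvgM; first by apply: fps_cvgM; apply: qpoch_inf_cvg.
apply: (fps_cvg_comp (u := qfactV x)); last exact: qfactV_cvg.
by move=> N; exists N => n; lia.
Qed.

End Limits.

(** * The pair of the double sum *)

Section Slater.
Variable R : comUnitRingType.
Implicit Types (x y z w : fps R).

(** The case z = 1, w = x of [finite_jtp], where (1;x)_n vanishes for n > 0. *)
Lemma unit_pair x : x 0%N = 0 ->
  bailey_pair x (theta x 1 x) (fun n => (n == 0%N)%:R).
Proof.
move=> x0 n; rewrite -(finite_jtp x0 (mul1r x) n).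
case: n => [|n]; first by rewrite !qpoch0 muln0 qfactV0 !mulr1.
by rewrite /qpoch big_ord_recl expr0 mulr1 subrr !mul0r.
Qed.

(** Only r = 0 contributes to the new beta, since the pair in base x^2 is the
    unit pair. *)
Lemma slater_pair x : x 0%N = 0 ->
  bailey_pair x (dilate x (theta (x ^+ 2) 1 (x ^+ 2)))
    (fun n => qfactV x n / qpoch x (x ^+ 2) n).
Proof.
move=> x0 n; have y0 : (x ^+ 2) 0%N = 0 by exact: fps_expr0.
rewrite -(base_change x0 (unit_pair y0) n) big_ord_recl big1 => [|r _].
  rewrite muln0 expr0 qfactVB0 mul1r addr0 [RHS]mulrC.
  by congr (_ * _); rewrite -[LHS]mulr1.
by rewrite lift0 mulr0.
Qed.

Lemma qpochs_inf3 x y z w :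
  qpochs_inf [:: y; z; w] x = qpoch_inf y x * qpoch_inf z x * qpoch_inf w x.
Proof. by rewrite /qpochs_inf !big_cons big_nil mulr1 mulrA. Qed.

Definition slater_alpha x := dilate x (dilate (x ^+ 2) (theta (x ^+ 4) 1 (x ^+ 4))).

Lemma theta_exp x a b c k : theta (x ^+ a) (x ^+ b) (x ^+ c) k.+1 =
  (-1) ^+ k.+1 * (x ^+ (a * 'C(k.+1, 2) + b * k.+1) +
                  x ^+ (a * 'C(k.+1, 2) + c * k.+1)).
Proof.
by rewrite /theta /theta_half -(exprM x a) -(exprM x b) -(exprM x c) !exprD; ring.
Qed.

(** The weights of the two dilations and of Bailey's lemma are x^(4k^2), x^(8k^2)
    and x^(16k^2); with k^2 = k + 2 (k choose 2) they turn the base x^4 of the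
    theta term into x^60. *)
Lemma slater_alpha4 x k : x ^+ ((4 * k) ^ 2) * slater_alpha x (4 * k) =
  theta (x ^+ 60) (x ^+ 28) (x ^+ 32) k.
Proof.
rewrite /slater_alpha (_ : 4 * k = 2 * (2 * k))%N; last by rewrite mulnA.
rewrite !dilate_double; case: k => [|k]; first by rewrite !muln0 !expr0 !mulr1.
have bin2k : (k.+1 * k.+1 = k.+1 + 2 * 'C(k.+1, 2))%N.
  by rewrite -mul_bin_diag bin1 /=; lia.
rewrite (theta_exp x 60 28 32) -{1}(expr0 x) (theta_exp x 4 0 4) -(exprM x 2).
set b := 'C(k.+1, 2) in bin2k *.
have -> : ((2 * (2 * k.+1)) ^ 2 = 32 * b + 16 * k.+1)%N by rewrite -mulnn; lia.
have -> : (2 * (2 * k.+1) ^ 2 = 16 * b + 8 * k.+1)%N by rewrite -mulnn; lia.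
have -> : (2 * (2 * k.+1 ^ 2) = 8 * b + 4 * k.+1)%N by rewrite -mulnn; lia.
have -> : (60 * b + 28 * k.+1 = 32 * b + 16 * k.+1 + (16 * b + 8 * k.+1 +
    (8 * b + 4 * k.+1 + (4 * b + 0 * k.+1))))%N by lia.
have -> : (60 * b + 32 * k.+1 = 32 * b + 16 * k.+1 + (16 * b + 8 * k.+1 +
    (8 * b + 4 * k.+1 + (4 * b + 4 * k.+1))))%N by lia.
rewrite !(exprD _ (32 * b + 16 * k.+1)) !(exprD _ (16 * b + 8 * k.+1)).
rewrite !(exprD _ (8 * b + 4 * k.+1)).
by ring.
Qed.

Lemma slater_alpha_series x : x 0%N = 0 ->
  fps_series (fun m => x ^+ (m ^ 2) * slater_alpha x m) =
  fps_series (theta (x ^+ 60) (x ^+ 28) (x ^+ 32)).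
Proof.
move=> x0; pose a m := x ^+ (m ^ 2) * slater_alpha x m.
have z0 n : (x ^+ n.+1) 0%N = 0 by exact: fps_expr0.
apply: fpsP => j.
rewrite -(fps_series_trunc (summable_square (slater_alpha x) x0)
  (n := j.+1) (N := 4 * j.+1)) //; last lia.
rewrite -(fps_series_trunc (summable_theta (x ^+ 60) (z0 27%N) (z0 31%N)) (leqnn j.+1)) //.
have a0 m : odd m -> a m = 0 by move=> om; rewrite /a /slater_alpha /dilate om mulr0.
have a2 m : odd m -> a (2 * m)%N = 0.
  by move=> om; rewrite /a /slater_alpha dilate_double /dilate om !mulr0.
have -> : (4 * j.+1 = 2 * (2 * j.+1))%N by rewrite mulnA.
rewrite (sum_even _ a0) (sum_even (f := fun m => a (2 * m)%N) _ a2).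
congr (fps_coef _ _); apply: eq_bigr => k _.
by rewrite /a mulnA slater_alpha4.
Qed.

Lemma mod60_series x : x 0%N = 0 ->
  fps_series (fun m => x ^+ (m ^ 2) * slater_alpha x m) =
  qpochs_inf [:: x ^+ 28; x ^+ 32; x ^+ 60] (x ^+ 60).
Proof.
move=> x0; have z0 n : (x ^+ n.+1) 0%N = 0 by exact: fps_expr0.
have zw : x ^+ 28 * x ^+ 32 = x ^+ 60 by rewrite -exprD.
rewrite (slater_alpha_series x0) qpochs_inf3.
exact: (jacobi_triple_product (z0 27%N) (z0 31%N) zw).
Qed.

Let regroup (e f a b c d : fps R) :
    a \is a GRing.unit -> b \is a GRing.unit -> c \is a GRing.unit ->
    d \is a GRing.unit ->
  e * f / (a * b * c * d) = e * (a^-1 * (f * d^-1 * (b^-1 / c))).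
Proof. by move=> ua ub uc ud; rewrite !invrM ?unitrM ?ua ?ub //; ring. Qed.

Lemma slater_double_sum x : x 0%N = 0 ->
  fps_has_sum
    (fun p : nat * nat =>
       let: (n, r) := p in
       if (n < 2 * r)%N then 0
       else x ^+ (n ^ 2 + 2 * r ^ 2)
            / (qpoch x (x ^+ 2) n * qpoch (x ^+ 2) (x ^+ 2) r
               * qpoch (x ^+ 2) (x ^+ 4) r * qpoch x x (n - 2 * r)))
    (qpochs_inf [:: x ^+ 28; x ^+ 32; x ^+ 60] (x ^+ 60) / qpoch_inf x x).
Proof.
move=> x0; have y0 : (x ^+ 2) 0%N = 0 by exact: fps_expr0.
have pair := base_change x0 (slater_pair y0).
rewrite -(exprM x 2 2) in pair.
rewrite -(mod60_series x0) -(bailey_limit x0 pair).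
set u := fun p : nat * nat => _.
have uE n r : u (n, r) = x ^+ (n ^ 2) * ((qpoch x (x ^+ 2) n)^-1 *
    (x ^+ (2 * r ^ 2) * qfactVB x n (2 * r) * (qfactV (x ^+ 2) r / qpoch (x ^+ 2) (x ^+ 4) r))).
  rewrite /u /qfactVB; case: ltnP => _; first by rewrite !(mulr0, mul0r).
  by rewrite exprD; apply: regroup; apply: qpoch_unit.
rewrite (_ : fps_series _ = fps_series (fun n => \sum_(r < n.+1) u (n, val r))).
  apply: triangle_has_sum => n r; last first.
    by rewrite uE; apply: (summable_square (fun _ => _) x0).
  by move=> nr; rewrite /u (_ : (n < 2 * r)%N) //; lia.
congr fps_series; apply: boolp.funext => n; rewrite !mulr_sumr.
by apply: eq_bigr => r _; rewrite uE.
Qed.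

End Slater.

Theorem mainTheorem6 (F : fieldType) :
  let q : fps F := fpsX in
  fps_has_sum
    (fun p : nat * nat =>
       let: (n, r) := p in
       if (n < 2 * r)%N then 0
       else q ^+ (n ^ 2 + 2 * r ^ 2)
            / (qpoch q (q ^+ 2) n * qpoch (q ^+ 2) (q ^+ 2) r
               * qpoch (q ^+ 2) (q ^+ 4) r * qpoch q q (n - 2 * r)))
    (qpochs_inf [:: q ^+ 28; q ^+ 32; q ^+ 60] (q ^+ 60) / qpoch_inf q q).
Proof. by move=> q; apply: slater_double_sum. Qed.
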